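(* Let $C$ be formed by adding $k_h$ hyperplanes to the description of $\bar C$, and let $(\mathcal P,\mathcal R)$ denote the point-ray collection obtained from intersecting the edges of $C$ with $\operatorname{bd}S$. The cardinality of $\mathcal P$ can grow exponentially large in $k_h$.
   Context: $P=\{x\in\mathbb R^n: Ax\ge b,\ x\ge 0\}$ (rational data) is a full-dimensional pointed polyhedron, $I\subseteq\{1,\dots,n\}$, and $P_I=\{x\in P: x_j\in\mathbb Z \text{ for all } j\in I\}$. For $c\in\mathbb Q^n$, $\bar x$ is an optimal basic feasible solution of $\min\{c^{T}x: x\in P\}$. $\bar C$ is the polyhedral cone with apex $\bar x$ defined by the $n$ hyperplanes corresponding to the nonbasic variables at $\bar x$. $S$ is a closed convex set with no point of $P_I$ in its interior and with $\bar x\in\operatorname{int}S$. Adding hyperplanes to the description of $\bar C$ means adding the inequalities corresponding to hyperplanes that define $P$ but not $\bar C$, so that $C$ is a relaxation of $P$ at least as tight as $\bar C$. The point-ray collection obtained from intersecting the edges of $C$ with $\operatorname{bd}S$ consists of the set $\mathcal P$ of intersection points of edges of $C$ with $\operatorname{bd}S$ and the set $\mathcal R$ of rays given by the (unbounded) edges of $C$ that do not intersect $\operatorname{bd}S$. *)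

(* Defs.v *)
From HB Require Import structures.
From mathcomp Require Import all_boot all_order all_algebra finmap.
From mathcomp Require Import all_classical all_reals all_analysis.

Set Implicit Arguments.
Unset Strict Implicit.
Unset Printing Implicit Defensive.

Import Order.TTheory GRing.Theory Num.Theory numFieldNormedType.Exports.

Local Open Scope classical_set_scope.
Local Open Scope ring_scope.

Section ConvexGeometry.
Variables (R : realType) (n : nat).
Implicit Types (F C S : set 'cV[R]_n) (x y u : 'cV[R]_n).

Definition bd S : set 'cV[R]_n := closure S `\` S°.

Definition dot (u x : 'cV[R]_n) : R := (u^T *m x) 0 0.

(* U is the linear span of F - x0, i.e. the direction space of the affine hull
   of F; it does not depend on the choice of x0 in F. *)
Definition affine_dim F (d : nat) : Prop :=
  exists2 x0, F x0 &
  exists2 U : {vspace 'cV[R]_n}, \dim U = d &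
  forall V : {vspace 'cV[R]_n},
    (U <= V)%VS <-> (forall x, F x -> x - x0 \in V).

Definition pointed C : Prop :=
  forall x u, (forall t : R, C (x + t *: u)) -> u = 0.

Definition face C F : Prop :=
  exists (u : 'cV[R]_n) (r : R),
    (forall x, C x -> r <= dot u x) /\ F = [set x | C x /\ dot u x = r].

Definition edge C F : Prop := face C F /\ affine_dim F 1.

(* A ray of the collection is represented by the unbounded edge it comes from. *)
Definition point_ray_collection C S :
    set 'cV[R]_n * set (set 'cV[R]_n) :=
  ([set x | bd S x /\ exists2 F, edge C F & F x],
   [set F | [/\ edge C F, ~ bounded_set F & F `&` bd S = set0]]).

End ConvexGeometry.

Section Polyhedron.
Variables (R : realType) (m n : nat).
Variables (A : 'M[rat]_(m, n)) (b : 'cV[rat]_m).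
Implicit Types (x : 'cV[R]_n) (J B H : {set 'I_(n + m)}).

(* The variables of the standard form Ax - s = b, x >= 0, s >= 0: the first n
   indices are the structural variables x, the last m the surpluses s. Thus each
   j : 'I_(n + m) indexes one inequality of the description of P. *)
Definition variables x : 'cV[R]_(n + m) :=
  col_mx x (map_mx ratr A *m x - map_mx ratr b).

Definition hyperplane (j : 'I_(n + m)) : set 'cV[R]_n :=
  [set x | variables x j 0 = 0].

Definition relaxation J : set 'cV[R]_n :=
  [set x | forall j, j \in J -> 0 <= variables x j 0].

Definition polyhedron : set 'cV[R]_n := relaxation [set: 'I_(n + m)]%SET.

Definition mixed_integer_points (I : {set 'I_n}) : set 'cV[R]_n :=
  [set x | polyhedron x /\ forall j, j \in I -> x j 0 \is a Num.int].

Definition is_basis B : Prop :=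
  #|B| = m /\
  \rank (colsub (enum_val : 'I_#|B| -> 'I_(n + m)) (row_mx A (- 1%:M))) = m.

Definition basic_feasible_solution B x : Prop :=
  [/\ is_basis B, forall j, j \notin B -> variables x j 0 = 0 & polyhedron x].

Definition optimal (c : 'cV[rat]_n) x : Prop :=
  polyhedron x /\
  forall y, polyhedron y -> dot (map_mx ratr c) x <= dot (map_mx ratr c) y.

(* The cone with apex at the basic solution: the inequalities of the nonbasic
   variables. *)
Definition basis_cone B : set 'cV[R]_n := relaxation (~: B)%SET.

Record cut_setting (I : {set 'I_n}) (c : 'cV[rat]_n) B x
    (S : set 'cV[R]_n) : Prop := CutSetting {
  full_dimensional : affine_dim polyhedron n;
  pointed_polyhedron : pointed polyhedron;
  bfs_basis : basic_feasible_solution B x;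
  bfs_optimal : optimal c x;
  closed_S : closed S;
  convex_S : convex_set (S : set (convex_lmodType 'cV[R]_n));
  lattice_free_S : S° `&` mixed_integer_points I = set0;
  apex_in_S : S° x }.

(* C arises from the basis cone by adding the inequalities of k hyperplanes,
   pairwise distinct and distinct from those defining the cone. *)
Definition adds_hyperplanes B (k : nat) (C : set 'cV[R]_n) : Prop :=
  exists H, [/\ H \subset B, #|H| = k,
    {in (~: B :|: H)%SET &, injective hyperplane} &
    C = basis_cone B `&` relaxation H].

End Polyhedron.

(* Main.v *)
Require Import Defs.
From mathcomp Require Import all_boot all_order all_algebra finmap.
From mathcomp Require Import all_classical all_reals all_analysis.
From mathcomp Require Import lra.

Set Implicit Arguments.
Unset Strict Implicit.
Unset Printing Implicit Defensive.

Import Order.TTheory GRing.Theory Num.Theory numFieldNormedType.Exports.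

Local Open Scope classical_set_scope.
Local Open Scope ring_scope.

(** The example is a prism over a k-cube.  In dimension n = k + 1, write 0 for
    the first coordinate and j for the others, and let P = [0, 1/2]^n, described
    by x <= 1/2 componentwise together with the sign constraints.  All variables
    are integer, so the origin is the only feasible integer point.  Maximizing
    x_0 has the optimal basic solution (1/2, 0, ..., 0), and its cone is
    x_0 <= 1/2, x_j >= 0.  The closed half-space S = {x_0 >= 0} contains this
    apex in its interior x_0 > 0, which avoids the origin.

    The k added hyperplanes are x_j = 1/2.  They turn the cone into the prism
    C = {x_0 <= 1/2} x [0, 1/2]^k, which has one vertical edge for each of the
    2^k vertices of the cube; each of them crosses bd S = {x_0 = 0} exactly once.
    Hence a = 1, alpha = 2, and n is linear in k ([d = 1]).

    Two facts make this precise.  Every vertical line over a cube vertex is an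
    edge, because it minimizes a functional with coefficients +1 and -1 on the
    cube coordinates ([vertical_edgeP]).  Conversely, no other point of bd S lies
    on an edge ([prism_points]): there the x_0 direction is free in C, and if
    some x_j were strictly between 0 and 1/2, that direction would be free too.
    A face containing a point contains every segment of C centred at that point
    ([face_extreme]), so its dimension would be at least 2
    ([edge_collinear]). *)

(** * Faces and edges *)

Lemma dot_delta (R : realType) n (i : 'I_n) (a : R) (x : 'cV[R]_n) :
  dot (a *: delta_mx i 0) x = a * x i 0.
Proof.
rewrite /dot mxE (bigD1 i) //= big1 ?addr0 => [|j ji].
  by rewrite !mxE !eqxx mulr1.
by rewrite !mxE (negPf ji) mulr0 mul0r.
Qed.

(** A linear functional that is minimal at the midpoint of a segment is constant
    on the segment. *)
Lemma face_extreme (R : realType) n (C F : set 'cV[R]_n) x w :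
  face C F -> F x -> C (x + w) -> C (x - w) -> F (x + w).
Proof.
move=> [u [r [Cr ->]]] [Cx xr] Cp Cm; split=> //.
have := Cr _ Cp; have := Cr _ Cm; move: xr.
rewrite /dot !mulmxDr !mulmxN !mxE; lra.
Qed.

(** Used to refute that a set is an edge, by exhibiting two independent
    directions in it. *)
Lemma edge_collinear (R : realType) n (C F : set 'cV[R]_n) x u v :
  edge C F -> F x -> F (x + u) -> F (x + v) -> u != 0 ->
  exists t, v = t *: u.
Proof.
move=> [_ [x0 _ [U dimU UF]]] Fx Fu Fv u0.
(* The direction space itself contains all differences of points of F. *)
have /UF mem : (U <= U)%VS by [].
have dir w : F (x + w) -> w \in U.
  move=> Fw; rewrite (_ : w = x + w - x0 - (x - x0)).
    by rewrite rpredB ?mem.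
  by rewrite opprB addrA subrK addrAC subrr add0r.
suff /eqP eU : <[u]>%VS == U.
  by apply/vlineP; rewrite eU dir.
by rewrite eqEdim dim_vline u0 dimU -memvE dir.
Qed.

(** * Coordinate half-spaces *)

Lemma interior_halfspace (R : realType) n (i : 'I_n) :
  [set x : 'cV[R]_n | 0 <= x i 0]° = [set x | 0 < x i 0].
Proof.
apply/seteqP; split=> x /=.
  move=> /nbhs_ballP[e /= e0 xe].
  (* Moving from x towards the boundary by half the radius of the ball
     stays in the half-space. *)
  have /xe : ball x e (x - (e / 2) *: delta_mx i 0).
    split=> // l j; rewrite /ball /= !mxE opprD addrA subrr sub0r opprK.
    by case: (_ && _); rewrite /= ?mulr1 ?mulr0 ?normr0 // ger0_norm; lra.
  rewrite /= !mxE !eqxx /= mulr1; lra.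
move=> x0; have : open [set y : 'cV[R]_n | 0 < y i 0].
  apply: (@open_comp _ _ (fun y : 'cV[R]_n => y i 0) [set z | 0 < z]).
    by move=> y _; exact: coord_continuous.
  exact: open_gt.
move=> opos; have : nbhs x [set y : 'cV[R]_n | 0 < y i 0].
  exact: open_nbhs_nbhs.
by apply: filterS => y /=; exact: ltW.
Qed.

Lemma closed_halfspace (R : realType) n (i : 'I_n) :
  closed [set x : 'cV[R]_n | 0 <= x i 0].
Proof.
apply: (@preimage_closed _ _ (fun y : 'cV[R]_n => y i 0) [set z | 0 <= z]).
  by move=> y _; exact: coord_continuous.
exact: closed_ge.
Qed.

Lemma bd_halfspace (R : realType) n (i : 'I_n) :
  bd [set x : 'cV[R]_n | 0 <= x i 0] = [set x | x i 0 = 0].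
Proof.
rewrite /bd; have /closure_id <- := @closed_halfspace R n i.
rewrite interior_halfspace.
apply/seteqP; split=> x /=.
  by move=> [x0 /negP]; rewrite -leNgt => x0'; apply/le_anti/andP.
by move=> ->; rewrite ltxx.
Qed.

Lemma convex_halfspace (R : realType) n (i : 'I_n) :
  convex_set ([set x : 'cV[R]_n | 0 <= x i 0] :
    set (convex_lmodType 'cV[R]_n)).
Proof.
move=> x y t; rewrite !inE /= => x0 y0.
(* Convex combinations of vectors are defined by this scaled sum. *)
change (0 <= (t%:num *: (x : 'cV[R]_n) + (1 - t%:num) *: (y : 'cV[R]_n)) i 0).
by rewrite !mxE addr_ge0 // mulr_ge0 // subr_ge0.
Qed.

(** * The cube and its optimal basis *)

Section HalfCube.
Variables (R : realType) (k : nat).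
Local Notation n := k.+1.
Local Notation A := (- 1%:M : 'M[rat]_n).
Local Notation b := (const_mx (- 2^-1) : 'cV[rat]_n).
Implicit Types (x : 'cV[R]_n) (i : 'I_n) (j : 'I_k) (W : {set 'I_k}).

Lemma variables_lshift x i : variables A b x (lshift n i) 0 = x i 0.
Proof. by rewrite /variables col_mxEu. Qed.

Lemma variables_rshift x i : variables A b x (rshift n i) 0 = 2^-1 - x i 0.
Proof.
rewrite /variables col_mxEd map_mxN map_scalar_mx rmorph1 mulNmx mul1mx !mxE.
by rewrite rmorphN fmorphV rmorph_nat opprK addrC.
Qed.

Definition variablesE := (variables_lshift, variables_rshift).

Lemma half_cubeE x :
  polyhedron A b x <-> forall i, 0 <= x i 0 <= 2^-1.
Proof.
split=> [Px i|Px l _].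
  have := Px (lshift n i) (finset.in_setT _).
  have := Px (rshift n i) (finset.in_setT _).
  by rewrite !variablesE subr_ge0 => -> ->.
have [i ->|i ->] := split_ordP l; rewrite variablesE ?subr_ge0;
  by case/andP: (Px i).
Qed.

Lemma half_cube_delta i : polyhedron A b (2^-1 *: delta_mx i 0 : 'cV[R]_n).
Proof.
by apply/half_cubeE => l; rewrite !mxE eqxx andbT; case: eqP => _ /=; lra.
Qed.

Lemma half_cube_full : affine_dim (polyhedron A b : set 'cV[R]_n) n.
Proof.
exists 0; first by apply/half_cubeE => i; rewrite mxE; lra.
exists fullv; first by rewrite dimvf /dim /= muln1.
move=> V; split=> [VT x _|PV]; first exact: (subvP VT) (memvf _).
apply/subvP => x _.
rewrite [x]matrix_sum_delta; apply: rpred_sum => i _; rewrite big_ord1 ord1.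
have := PV _ (half_cube_delta i); rewrite subr0 => /(rpredZ (2 * x i 0)).
by rewrite scalerA mulrAC divff ?mul1r ?pnatr_eq0.
Qed.

Lemma half_cube_pointed : pointed (polyhedron A b : set 'cV[R]_n).
Proof.
move=> x u line; apply/matrixP => i l; rewrite ord1 mxE; apply/eqP/negP => ui.
(* At this parameter the i-th coordinate of the line equals 1. *)
have /half_cubeE/(_ i) := line ((1 - x i 0) / u i 0).
rewrite !mxE divfK //; first lra.
exact/negP.
Qed.

(** Every row [- x_i - s_i = - 1/2] has two variables.  At the apex, where only
    [x_0] is nonzero, exactly one variable of each row is nonzero, and it is the
    basic one. *)
Definition basic_var i : 'I_(n + n) :=
  if i == ord0 then lshift n i else rshift n i.

Definition prism_basis : {set 'I_(n + n)} := [set basic_var i | i : 'I_n]%SET.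

Lemma basic_var_inj : injective basic_var.
Proof.
move=> i i'; rewrite /basic_var.
case: (i =P ord0) (i' =P ord0) => [->|_] [->|_] //.
exact: rshift_inj.
Qed.

Lemma lshift_basis i : (lshift n i \in prism_basis) = (i == ord0).
Proof.
apply/imsetP/eqP => [[i' _]|->]; last first.
  by exists ord0; rewrite // /basic_var eqxx.
rewrite /basic_var; case: eqP => [->|_ /eqP]; first exact: lshift_inj.
by rewrite eq_lrshift.
Qed.

Lemma rshift_basis i : (rshift n i \in prism_basis) = (i != ord0).
Proof.
apply/imsetP/idP => [[i' _]|i0]; last first.
  by exists i; rewrite // /basic_var (negPf i0).
rewrite /basic_var; case: (altP (i' =P ord0)) => [_ /eqP|i0 /rshift_inj -> //].
by rewrite eq_rlshift.
Qed.

Lemma card_prism_basis : #|prism_basis| = n.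
Proof. by rewrite card_imset ?card_ord //; exact: basic_var_inj. Qed.

(** Up to sign the basic columns form a permutation matrix: the column of
    [basic_var i] has its only nonzero entry, -1, in row i. *)
Lemma prism_basisP : is_basis A prism_basis.
Proof.
split; first exact: card_prism_basis.
apply/eqP/inj_row_free => v vM; apply/rowP => i; rewrite mxE.
have iB : basic_var i \in prism_basis by apply: imset_f.
have /rowP/(_ (enum_rank_in iB (basic_var i))) := vM.
rewrite mxE [RHS]mxE (bigD1 i) //= big1 => [|i' ii'].
  rewrite mxE enum_rankK_in // /basic_var; case: eqP => _;
  by rewrite ?row_mxEl ?row_mxEr !mxE eqxx mulrN1 addr0 => /eqP;
    rewrite oppr_eq0 => /eqP.
rewrite mxE enum_rankK_in // /basic_var; case: eqP => _;
by rewrite ?row_mxEl ?row_mxEr !mxE (negPf ii') oppr0 mulr0.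
Qed.

Definition prism_apex : 'cV[R]_n := 2^-1 *: delta_mx ord0 0.

Lemma prism_apex_bfs : basic_feasible_solution A b prism_basis prism_apex.
Proof.
split; [exact: prism_basisP| |exact: half_cube_delta].
move=> l; have [i ->|i ->] := split_ordP l.
  rewrite lshift_basis variablesE !mxE eqxx andbT => /negPf ->.
  by rewrite mulr0.
rewrite rshift_basis negbK variablesE !mxE => /eqP ->.
by rewrite !eqxx mulr1 subrr.
Qed.

(** Each hyperplane contains a point that lies on no other one: set the
    coordinate in question to its bound and all others to 1. *)
Lemma hyperplane_inj : injective (@hyperplane R n n A b).
Proof.
pose test l : 'cV[R]_n := \col_i
  if l == lshift n i then 0 else if l == rshift n i then 2^-1 else 1.
have testl l i : test l i 0 =
  if l == lshift n i then 0 else if l == rshift n i then 2^-1 else 1.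
  by rewrite mxE.
have test_in l : hyperplane A b l (test l).
  rewrite /hyperplane /=; have [i ->|i ->] := split_ordP l;
  rewrite variablesE testl ?eqxx // eq_rlshift; lra.
have test_only l l' : hyperplane A b l' (test l) -> l' = l.
  rewrite /hyperplane /=; have [i ->|i ->] := split_ordP l';
  rewrite variablesE testl; have [-> //|_] := eqVneq l (lshift n i).
  - by case: ifP => _ E; exfalso; lra.
  - by move=> E; exfalso; lra.
  - by have [-> //|_] := eqVneq l (rshift n i) => E; exfalso; lra.
by move=> l l' E; apply: test_only; rewrite E.
Qed.

(** * The prism and its edges *)

Definition bounding_vars : {set 'I_(n + n)} :=
  [set rshift n (lift ord0 j) | j : 'I_k]%SET.

Definition prism : set 'cV[R]_n :=
  [set x | x ord0 0 <= 2^-1 /\ forall j, 0 <= x (lift ord0 j) 0 <= 2^-1].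

Lemma prismE :
  basis_cone A b prism_basis `&` relaxation A b bounding_vars = prism.
Proof.
apply/seteqP; split=> x.
  move=> [Kx Hx]; split.
    have := Kx (rshift n ord0); rewrite !inE rshift_basis eqxx variablesE.
    by rewrite subr_ge0; exact.
  move=> j; apply/andP; split.
    have := Kx (lshift n (lift ord0 j)); rewrite !inE lshift_basis variablesE.
    exact.
  have := Hx (rshift n (lift ord0 j)); rewrite variablesE subr_ge0; apply.
  exact: imset_f.
move=> [x0 xj]; split=> l.
  rewrite !inE; have [i ->|i ->] := split_ordP l.
    rewrite lshift_basis variablesE; case: (unliftP ord0 i) => [j|] -> //.
    by case/andP: (xj j).
  by rewrite rshift_basis negbK variablesE subr_ge0 => /eqP ->.
by case/imsetP => j _ ->; rewrite variablesE subr_ge0; case/andP: (xj j).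
Qed.

Lemma prism_adds_hyperplanes : adds_hyperplanes A b prism_basis k prism.
Proof.
exists bounding_vars; split.
- by apply/fintype.subsetP => l /imsetP[j _ ->]; rewrite rshift_basis.
- rewrite card_imset ?card_ord // => j j' /rshift_inj; exact: lift_inj.
- by move=> l l' _ _; exact: hyperplane_inj.
- by rewrite prismE.
Qed.

(** The vertex of the cube [x_0 = 0] whose coordinates equal to 1/2 are those in
    [W]; it is where the vertical edge over [W] leaves S. *)
Definition bottom_vertex W : 'cV[R]_n :=
  \col_i if unlift ord0 i is Some j then if j \in W then 2^-1 else 0 else 0.

Lemma bottom_vertex0 W : bottom_vertex W ord0 0 = 0.
Proof. by rewrite mxE unlift_none. Qed.

Lemma bottom_vertex_lift W j :
  bottom_vertex W (lift ord0 j) 0 = if j \in W then 2^-1 else 0.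
Proof. by rewrite mxE liftK. Qed.

Lemma bottom_vertex_inj : injective bottom_vertex.
Proof.
move=> W W' /colP E; apply/setP => j.
have := E (lift ord0 j); rewrite !bottom_vertex_lift.
by case: ifP; case: ifP => // _ _; lra.
Qed.

Definition vertical_edge W : set 'cV[R]_n :=
  [set x | prism x /\
    forall j, x (lift ord0 j) 0 = bottom_vertex W (lift ord0 j) 0].

Lemma vertical_edge_bottom W t :
  t <= 2^-1 -> vertical_edge W (bottom_vertex W + t *: delta_mx ord0 0).
Proof.
move=> t12; split; first split.
- by rewrite mxE bottom_vertex0 !mxE !eqxx mulr1 add0r.
- move=> j; rewrite mxE bottom_vertex_lift !mxE /= mulr0 addr0.
  by case: ifP => _; lra.
- by move=> j; rewrite mxE bottom_vertex_lift !mxE /= mulr0 addr0.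
Qed.

(** The functional pushing each cube coordinate towards the end of [0, 1/2]
    prescribed by [W] is minimal exactly on the vertical line, since the gap to
    the minimum is a sum of nonnegative terms, one for each coordinate. *)
Lemma vertical_edgeP W : edge prism (vertical_edge W).
Proof.
split.
  pose u : 'cV[R]_n := \col_i
    if unlift ord0 i is Some j then if j \in W then -1 else 1 else 0.
  have dotu x y : dot u x - dot u y =
      \sum_j (if j \in W then -1 else 1) *
         (x (lift ord0 j) 0 - y (lift ord0 j) 0).
    rewrite /dot !mxE !big_ord_recl !mxE unlift_none !mul0r !add0r -sumrB.
    by apply: eq_bigr => j _; rewrite !mxE liftK mulrBr.
  have ge0 x : prism x -> forall j, 0 <= (if j \in W then -1 else 1) *
         (x (lift ord0 j) 0 - bottom_vertex W (lift ord0 j) 0).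
    move=> [_ xj] j; have := xj j; rewrite bottom_vertex_lift.
    by case: ifP => _; lra.
  exists u, (dot u (bottom_vertex W)); split=> [x Px|].
    by rewrite -subr_ge0 dotu sumr_ge0 // => j _; exact: ge0.
  apply/seteqP; split=> x [Px].
    move=> xj; split=> //; apply/eqP; rewrite -subr_eq0 dotu big1 // => j _.
    by rewrite xj subrr mulr0.
  move=> /eqP; rewrite -subr_eq0 dotu psumr_eq0 => [/allP all0|j _];
    last exact: ge0.
  split=> // j; have := all0 j (mem_index_enum _); rewrite mulf_eq0 subr_eq0.
  by case: ifP => _; rewrite ?oppr_eq0 oner_eq0 => /eqP.
exists (bottom_vertex W).
  have := @vertical_edge_bottom W 0; rewrite scale0r addr0; apply; lra.
exists <[delta_mx ord0 ord0]>%VS.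
  rewrite dim_vline; case: eqP => // /matrixP/(_ ord0 0).
  by rewrite !mxE !eqxx => /eqP; rewrite oner_eq0.
move=> V; rewrite -memvE; split=> [Vd x [_ xj]|Vx].
  rewrite (_ : x - _ = x ord0 0 *: delta_mx ord0 0) ?rpredZ //.
  apply/colP => i; rewrite !mxE.
  case: (unliftP ord0 i) => [j|] ->.
    by rewrite xj bottom_vertex_lift subrr /= mulr0.
  by rewrite !eqxx mulr1 subr0.
have := Vx _ (vertical_edge_bottom W (lexx _)); rewrite addrC addKr.
by move/(rpredZ 2); rewrite scalerA divff ?scale1r ?pnatr_eq0.
Qed.

(** An edge through a point of [x_0 = 0] contains a vertical segment, so the
    point cannot also be moved both ways along a cube coordinate. *)
Lemma prism_points :
  (point_ray_collection prism [set x | 0 <= x ord0 0]).1 = range bottom_vertex.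
Proof.
rewrite /point_ray_collection /= bd_halfspace.
apply/seteqP; split=> x /=; last first.
  move=> [W _ <-]; split; first exact: bottom_vertex0.
  exists (vertical_edge W); first exact: vertical_edgeP.
  have := @vertical_edge_bottom W 0; rewrite scale0r addr0; apply; lra.
move=> [x0 [F edgeF Fx]].
have [faceF _] := edgeF.
have [_ xj] : prism x by case: faceF Fx => u [r [_ ->]] [].
have Fe : F (x + 2^-1 *: delta_mx ord0 0).
  apply: (face_extreme faceF Fx); split=> [|j]; rewrite !mxE /=;
    have := xj; rewrite ?x0 ?mulr0 ?mulr1 ?oppr0 ?addr0; [lra|exact|lra|exact].
have binary j : x (lift ord0 j) 0 = 0 \/ x (lift ord0 j) 0 = 2^-1.
  have xj01 := xj j.
  (* This step keeps x_j + e and x_j - e in [0, 1/2], since both factors are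
     at most 1, and it vanishes only when x_j is at a bound. *)
  pose e := x (lift ord0 j) 0 * (2^-1 - x (lift ord0 j) 0).
  have [e0|e0] := eqVneq e 0.
    by move/eqP: e0; rewrite mulf_eq0 subr_eq0 => /orP[] /eqP; [left|right].
  have Fj : F (x + e *: delta_mx (lift ord0 j) 0).
    apply: (face_extreme faceF Fx); split=> [|j'].
    - by rewrite !mxE x0 mulr0; lra.
    - rewrite !mxE (inj_eq lift_inj) andbT; case: eqP => [->|_] /=.
        by rewrite /e mulr1; nra.
      by rewrite mulr0 addr0.
    - by rewrite !mxE x0 mulr0; lra.
    - rewrite !mxE (inj_eq lift_inj) andbT; case: eqP => [->|_] /=.
        by rewrite /e mulr1; nra.
      by rewrite mulr0 subr0.
  have [|t /matrixP/(_ (lift ord0 j) 0)] := edge_collinear edgeF Fx Fe Fj.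
    apply/eqP => /matrixP/(_ ord0 0).
    by rewrite !mxE /= mulr1; lra.
  by rewrite !mxE !eqxx /= mulr1 !mulr0 => /eqP; rewrite (negPf e0).
exists [set j | x (lift ord0 j) 0 == 2^-1]%SET => //.
apply/colP => i; case: (unliftP ord0 i) => [j|] ->.
  rewrite bottom_vertex_lift inE; case: eqP => [->//|].
  by case: (binary j).
by rewrite bottom_vertex0 x0.
Qed.

(** * The cut setting *)

Lemma prism_cut_setting :
  cut_setting A b [set: 'I_n]%SET (- delta_mx ord0 0) prism_basis prism_apex
    [set x : 'cV[R]_n | 0 <= x ord0 0].
Proof.
have apex0 : prism_apex ord0 0 = 2^-1 by rewrite !mxE !eqxx mulr1.
split.
- exact: half_cube_full.
- exact: half_cube_pointed.
- exact: prism_apex_bfs.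
- split=> [|y /half_cubeE/(_ ord0) y0]; first exact: half_cube_delta.
  rewrite map_mxN map_delta_mx -scaleN1r !dot_delta apex0; lra.
- exact: closed_halfspace.
- exact: convex_halfspace.
- rewrite interior_halfspace; apply/seteqP.
  split=> // x [/= x0 [/half_cubeE Px xZ]].
  have /intrP[z zx] := xZ ord0 (finset.in_setT _).
  have := Px ord0; rewrite zx in x0 *.
  (* An integer in ]0, 1/2] would be at least 1. *)
  have : (1 <= z)%R by rewrite -gtz0_ge1 -(ltr0z R).
  rewrite -(ler1z R); lra.
- rewrite interior_halfspace /= apex0; lra.
Qed.

End HalfCube.

Theorem proposition1 (R : realType) :
  exists (a alpha : R) (d : nat),
    [/\ 0 < a, 1 < alpha &
     forall k_h : nat,
     exists (n m : nat) (A : 'M[rat]_(m, n)) (b : 'cV[rat]_m)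
            (I : {set 'I_n}) (c : 'cV[rat]_n) (B : {set 'I_(n + m)})
            (xbar : 'cV[R]_n) (S C : set 'cV[R]_n),
       [/\ (n <= k_h.+1 ^ d)%N,
           cut_setting A b I c B xbar S,
           adds_hyperplanes A b B k_h C &
           let points := (point_ray_collection C S).1 in
           finite_set points /\
           a * alpha ^+ k_h <= (#|` fset_set points|)%:R]].
Proof.
exists 1, 2, 1%N; split; [lra|lra|move=> k].
do 2 exists k.+1; exists (- 1%:M), (const_mx (- 2^-1)), [set: 'I_k.+1]%SET.
exists (- delta_mx ord0 0), (prism_basis k), (prism_apex R k).
exists [set x | 0 <= x ord0 0], (@prism R k).
split; first by rewrite expn1.
- exact: prism_cut_setting.
- exact: prism_adds_hyperplanes.
rewrite prism_points; split; first exact: finite_image.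
have /perm_size -> : perm_eq (fset_set (range (@bottom_vertex R k)))
    [seq bottom_vertex R W | W : {set 'I_k}].
  apply: uniq_perm => [||x]; first exact: fset_uniq.
    by rewrite map_inj_uniq ?enum_uniq //; exact: bottom_vertex_inj.
  rewrite in_fset_set; last exact: finite_image.
  apply/idP/fintype.imageP => [|[W _ ->]]; rewrite inE; last by exists W.
  by move=> [W _ <-]; exists W.
rewrite size_image -cardsT -powersetT card_powerset cardsT card_ord.
by rewrite natrX mul1r.
Qed.
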